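(* Let $\mathbf a_1,\dots,\mathbf a_n\in\mathbb R^d$ be the rows of a rank-$d$ matrix, let $\mathbf w\in\mathbb R^n$ be any weights with $\mathbf M(\mathbf w)\succ0$, let $j\in[n]$ and $t>0$. Then for every $i\in[n]$, $$\big(\mathbf a_i^\top\mathbf M(\mathbf w)^{-1}\mathbf a_j\big)^2=\Big(v_i(\mathbf w)-v_i(\mathbf w+t\mathbf e_j)\Big)\cdot\frac{1+t\,v_j(\mathbf w)}{t}.$$ Consequently, if the optimal design is nondegenerate with contact set $S^\star$, $m=|S^\star|$, then for a design $\mathbf p\in\Delta_n$ with $\mathbf M(\mathbf p)\succ0$ the facial Hessian block $\widehat{\mathbf H}(\mathbf p)=\big((\mathbf a_i^\top\mathbf M(\mathbf p)^{-1}\mathbf a_j)^2\big)_{i,j\in S^\star}$ is computed exactly from the $m+1\le\binom{d+1}2+1$ leverage-score queries at the designs $\mathbf p$ and $\tfrac12(\mathbf p+\mathbf e_j)$, $j\in S^\star$, via the displayed identity with $t=1$ and the homogeneity $v_i(\mathbf w/2)=2v_i(\mathbf w)$.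
   Context: For $\mathbf p\in\mathbb R^n$, $\mathbf M(\mathbf p)=\sum_ip_i\mathbf a_i\mathbf a_i^\top$; when $\mathbf M(\mathbf p)\succ0$, $v_i(\mathbf p)=\mathbf a_i^\top\mathbf M(\mathbf p)^{-1}\mathbf a_i$. $\Delta_n=\{\mathbf p\ge0:\sum_ip_i=1\}$; its elements are designs; $\mathbf e_j$ is the $j$-th standard basis vector. A leverage-score query at $\mathbf w$ with $\mathbf M(\mathbf w)\succ0$ returns $(v_i(\mathbf w))_{i\in[n]}$. An optimal design $\mathbf p^\star$ minimizes $-\log\det\mathbf M(\mathbf p)$ over $\Delta_n$; its contact set is $S^\star=\{i:v_i(\mathbf p^\star)=d\}$; it is nondegenerate if $\operatorname{supp}\mathbf p^\star=S^\star$ (with $v_i(\mathbf p^\star)<d$ for $i\notin S^\star$) and the matrices $\{\mathbf a_i\mathbf a_i^\top\}_{i\in S^\star}$ are linearly independent (hence $m\le\binom{d+1}2$). *)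

(* Defs.v *)
From mathcomp Require Import all_boot all_order all_algebra.
From mathcomp Require Import all_classical all_reals all_analysis.

Set Implicit Arguments.
Unset Strict Implicit.
Unset Printing Implicit Defensive.

Import Order.TTheory GRing.Theory Num.Theory.
Local Open Scope ring_scope.

(* The vector a_i is [row i A], a row vector, so a_i a_i^T is
   [(row i A)^T *m row i A].  Weights are row vectors, and the standard basis
   vector e_j is [delta_mx 0 j]. *)

Definition posdefmx (R : realType) (d : nat) (M : 'M[R]_d) : Prop :=
  M^T = M /\ forall u : 'rV[R]_d, u != 0 -> 0 < (u *m M *m u^T) 0 0.

Definition outer (R : realType) (n d : nat) (A : 'M[R]_(n, d)) (i : 'I_n) :
    'M[R]_d :=
  (row i A)^T *m row i A.

Definition infomx (R : realType) (n d : nat) (A : 'M[R]_(n, d))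
    (p : 'rV[R]_n) : 'M[R]_d :=
  \sum_i p 0 i *: outer A i.

(* [invmx] is the identity on singular matrices: [cross_lev], [lev] and
   [facial_hessian] are meaningful only when [infomx A p] is invertible. *)
Definition cross_lev (R : realType) (n d : nat) (A : 'M[R]_(n, d))
    (p : 'rV[R]_n) (i j : 'I_n) : R :=
  (row i A *m invmx (infomx A p) *m (row j A)^T) 0 0.

Definition lev (R : realType) (n d : nat) (A : 'M[R]_(n, d))
    (p : 'rV[R]_n) (i : 'I_n) : R :=
  cross_lev A p i i.

Definition lev_query (R : realType) (n d : nat) (A : 'M[R]_(n, d))
    (w : 'rV[R]_n) : option 'rV[R]_n :=
  if `[< posdefmx (infomx A w) >] then Some (\row_i lev A w i) else None.

Definition design (R : realType) (n : nat) (p : 'rV[R]_n) : Prop :=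
  (forall i, 0 <= p 0 i) /\ \sum_i p 0 i = 1.

(* [lne] sends nonpositive reals to -oo, whereas [ln] sends them to 0: the
   objective is thus +oo at designs whose matrix is singular. *)
Definition neg_logdet (R : realType) (n d : nat) (A : 'M[R]_(n, d))
    (p : 'rV[R]_n) : \bar R :=
  (- lne (\det (infomx A p))%:E)%E.

Definition optimal_design (R : realType) (n d : nat) (A : 'M[R]_(n, d))
    (p : 'rV[R]_n) : Prop :=
  design p /\ forall q, design q -> (neg_logdet A p <= neg_logdet A q)%E.

Definition contact_set (R : realType) (n d : nat) (A : 'M[R]_(n, d))
    (p : 'rV[R]_n) : {set 'I_n} :=
  [set i | lev A p i == d%:R].

Definition supp (R : realType) (n : nat) (p : 'rV[R]_n) : {set 'I_n} :=
  [set i | p 0 i != 0].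

(* Linear independence is that of the family indexed by the contact set:
   [free] rejects repeated matrices. *)
Definition nondegenerate_design (R : realType) (n d : nat) (A : 'M[R]_(n, d))
    (p : 'rV[R]_n) : Prop :=
  [/\ supp p = contact_set A p,
      forall i, i \notin contact_set A p -> lev A p i < d%:R
    & free [seq outer A i | i <- enum (contact_set A p)]].

(* Rows and columns are numbered by the increasing enumeration of S. *)
Definition facial_hessian (R : realType) (n d : nat) (A : 'M[R]_(n, d))
    (S : {set 'I_n}) (p : 'rV[R]_n) : 'M[R]_#|S| :=
  \matrix_(k, l) cross_lev A p (enum_val k) (enum_val l) ^+ 2.

Definition query_points (R : realType) (n : nat) (S : {set 'I_n})
    (p : 'rV[R]_n) : seq 'rV[R]_n :=
  p :: [seq 2^-1 *: (p + delta_mx 0 j) | j <- enum S].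

(* The reconstruction sees the answers to the queries only, not A or p.
   Answer 0 is v(p), and answer l+1 is v((p + e_j)/2) = 2 v(p + e_j) for the
   l-th element j of S; the entry is the rank-one update identity at t = 1. *)
Definition hessian_of_answers (R : realType) (n : nat) (S : {set 'I_n})
    (ans : seq 'rV[R]_n) : 'M[R]_#|S| :=
  \matrix_(k, l)
    let i := enum_val k in
    let j := enum_val l in
    let v := nth 0 ans 0 in
    let vj := nth 0 ans l.+1 in
    (v 0 i - vj 0 i / 2) * (1 + v 0 j).

(* Main.v *)
(* Write M = M(w) and M' = M(w + t e_j) = M + t a_j a_j^T.  The resolvent
   identity gives M^-1 - M'^-1 = t M^-1 a_j a_j^T M'^-1, and testing it against
   (a_i, a_i) and (a_j, a_i) yields the displayed identity.  The bound on m holds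
   because the independent matrices a_i a_i^T are symmetric, hence lie in a space
   spanned by binom(d+1, 2) matrices. *)
Require Import Defs.
From mathcomp Require Import all_boot all_order all_algebra.
From mathcomp Require Import all_classical all_reals all_analysis.
From mathcomp Require Import ring.

Import Order.TTheory GRing.Theory Num.Theory.
Local Open Scope ring_scope.

Lemma posdefmx_unit (R : realType) (d : nat) (M : 'M[R]_d) :
  posdefmx M -> M \in unitmx.
Proof.
move=> [_ Mpos]; rewrite unitmxE unitfE; apply/negP => /det0P[v v0 vM].
by have := Mpos v v0; rewrite vM mul0mx mxE ltxx.
Qed.

Lemma posdefmxZ (R : realType) (d : nat) (c : R) (M : 'M[R]_d) :
  0 < c -> posdefmx M -> posdefmx (c *: M).
Proof.
move=> c0 [Msym Mpos]; split=> [|u u0]; first by rewrite linearZ /= Msym.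
by rewrite -scalemxAr -scalemxAl mxE mulr_gt0 // Mpos.
Qed.

(** The added term contributes [t] times the square of the scalar [u *m a^T] to the quadratic
    form. *)
Lemma posdefmx_rank1_update (R : realType) (d : nat) (M : 'M[R]_d)
    (a : 'rV[R]_d) (t : R) :
  0 <= t -> posdefmx M -> posdefmx (M + t *: (a^T *m a)).
Proof.
move=> t0 [Msym Mpos]; split=> [|u u0].
  by rewrite linearD linearZ /= trmx_mul trmxK Msym.
rewrite mulmxDr mulmxDl mxE ltr_wpDr ?Mpos //.
rewrite -scalemxAr -scalemxAl mxE mulr_ge0 //.
have -> : u *m (a^T *m a) *m u^T = (u *m a^T) *m (u *m a^T)^T.
  by rewrite trmx_mul trmxK !mulmxA.
by rewrite mxE big_ord1 [_^T _ _]mxE -expr2 sqr_ge0.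
Qed.

Lemma trmx_outer (R : realType) (n d : nat) (A : 'M[R]_(n, d)) (i : 'I_n) :
  (outer A i)^T = outer A i.
Proof. by rewrite /outer trmx_mul trmxK. Qed.

Lemma infomxD_delta (R : realType) (n d : nat) (A : 'M[R]_(n, d))
    (w : 'rV[R]_n) (t : R) (j : 'I_n) :
  infomx A (w + t *: delta_mx 0 j) = infomx A w + t *: outer A j.
Proof.
rewrite /infomx; under eq_bigr do rewrite !mxE scalerDl.
rewrite big_split /=; congr (_ + _).
rewrite (bigD1 j) //= !eqxx mulr1 big1 ?addr0 // => i /negPf ij.
by rewrite ij mulr0 scale0r.
Qed.

Lemma infomxZ (R : realType) (n d : nat) (A : 'M[R]_(n, d)) (w : 'rV[R]_n)
    (c : R) :
  infomx A (c *: w) = c *: infomx A w.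
Proof.
by rewrite /infomx scaler_sumr; apply: eq_bigr => i _; rewrite mxE scalerA.
Qed.

Lemma infomx_sym (R : realType) (n d : nat) (A : 'M[R]_(n, d)) (w : 'rV[R]_n) :
  (infomx A w)^T = infomx A w.
Proof.
rewrite /infomx linear_sum; apply: eq_bigr => i _.
by rewrite linearZ /= trmx_outer.
Qed.

Lemma cross_levC (R : realType) (n d : nat) (A : 'M[R]_(n, d)) (w : 'rV[R]_n)
    (i j : 'I_n) :
  cross_lev A w i j = cross_lev A w j i.
Proof.
rewrite /cross_lev; set B := invmx _.
have -> : row i A *m B *m (row j A)^T = (row j A *m B *m (row i A)^T)^T.
  by rewrite !trmx_mul trmxK trmx_inv infomx_sym mulmxA.
by rewrite mxE.
Qed.

Lemma posdef_infomxD_delta (R : realType) (n d : nat) (A : 'M[R]_(n, d))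
    (w : 'rV[R]_n) (j : 'I_n) (t : R) :
  posdefmx (infomx A w) -> 0 < t ->
  posdefmx (infomx A (w + t *: delta_mx 0 j)).
Proof.
by move=> Mpd t0; rewrite infomxD_delta; apply: posdefmx_rank1_update => //;
   exact: ltW.
Qed.

(** Resolvent identity tested against a general pair (a_i, a_k), so that one statement serves both
    the diagonal pair (i, i) and the mixed pair (j, i). *)
Lemma cross_lev_update (R : realType) (n d : nat) (A : 'M[R]_(n, d))
    (w : 'rV[R]_n) (j : 'I_n) (t : R) (i k : 'I_n) :
  let w' := w + t *: delta_mx 0 j in
  infomx A w \in unitmx -> infomx A w' \in unitmx ->
  cross_lev A w i k - cross_lev A w' i k =
    t * cross_lev A w i j * cross_lev A w' j k.
Proof.
move=> w' Mu M'u.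
have resolvent : invmx (infomx A w) - invmx (infomx A w') =
    t *: (invmx (infomx A w) *m outer A j *m invmx (infomx A w')).
  (* The rank-one term is M' - M, and M^-1 (M' - M) M'^-1 telescopes. *)
  have -> : t *: (invmx (infomx A w) *m outer A j *m invmx (infomx A w')) =
      invmx (infomx A w) *m (infomx A w' - infomx A w) *m invmx (infomx A w').
    by rewrite infomxD_delta addrAC subrr add0r -scalemxAr -scalemxAl.
  by rewrite mulmxBr mulmxBl mulmxK // mulVmx // mul1mx.
rewrite /cross_lev.
transitivity ((row i A *m (invmx (infomx A w) - invmx (infomx A w'))
   *m (row k A)^T) 0 0).
  by rewrite mulmxBr mulmxBl !mxE.
rewrite resolvent -scalemxAr -scalemxAl mxE /outer -mulrA; congr (_ * _).
set B := invmx _; set B' := invmx _.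
(* Since the middle matrix has the form a_j^T a_j, the product splits into two 1 x 1 factors. *)
have -> : row i A *m (B *m ((row j A)^T *m row j A) *m B') *m (row k A)^T =
    (row i A *m B *m (row j A)^T) *m (row j A *m B' *m (row k A)^T).
  by rewrite !mulmxA.
by rewrite mxE big_ord1.
Qed.

(** Let c = a_i M^-1 a_j^T and c' = a_j M'^-1 a_i^T. The update at (i, i) reads v_i(w) - v_i(w') = t
    c c', and at (j, i) it reads c = (1 + t v_j(w)) c'. Replacing one factor of c^2 by the latter
    leaves only a division by t. *)
Lemma sqr_cross_lev (R : realType) (n d : nat) (A : 'M[R]_(n, d))
    (w : 'rV[R]_n) (j : 'I_n) (t : R) (i : 'I_n) :
  posdefmx (infomx A w) -> 0 < t ->
  cross_lev A w i j ^+ 2 =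
    (lev A w i - lev A (w + t *: delta_mx 0 j) i) * ((1 + t * lev A w j) / t).
Proof.
move=> Mpd t0.
have Mu := posdefmx_unit _ _ _ Mpd.
have M'u := posdefmx_unit _ _ _ (posdef_infomxD_delta _ _ _ _ _ j _ Mpd t0).
have Eii := cross_lev_update _ _ _ _ w j t i i Mu M'u.
have Eji := cross_lev_update _ _ _ _ w j t j i Mu M'u.
rewrite /lev Eii expr2 {2}cross_levC.
move/eqP: Eji; rewrite subr_eq => /eqP ->.
by field; rewrite gt_eqF.
Qed.

Lemma lev_half (R : realType) (n d : nat) (A : 'M[R]_(n, d)) (w : 'rV[R]_n)
    (i : 'I_n) :
  posdefmx (infomx A w) -> lev A (2^-1 *: w) i = 2 * lev A w i.
Proof.
(* M is linear in the weights, so its inverse scales by the reciprocal of 1/2. *)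
move=> Mpd; rewrite /lev /cross_lev infomxZ invmxZ; last first.
  by rewrite -infomxZ; apply: posdefmx_unit; rewrite infomxZ; apply: posdefmxZ.
by rewrite invrK -scalemxAr -scalemxAl mxE.
Qed.

(** One symmetric matrix per unordered pair of indices, stored with j <= i; a diagonal pair yields
    twice the matrix unit. *)
Definition sym_gens (R : realType) (d : nat) : seq 'M[R]_d :=
  [seq delta_mx i j + delta_mx j i | i <- enum 'I_d,
    j <- [seq j : 'I_d <- enum 'I_d | (j <= i)%N]].

Lemma size_sym_gens (R : realType) (d : nat) :
  size (sym_gens R d) = 'C(d.+1, 2).
Proof.
rewrite size_allpairs_dep sumnE big_map -bin2_sum big_enum /=.
(* Dropping the zero term of 0 + 1 + ... + d shifts the index: row i must contribute i + 1 pairs. *)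
rewrite big_nat_recl // add0n big_mkord; apply: eq_bigr => i _.
rewrite size_filter -(count_map (@nat_of_ord d) (fun k => (k <= i)%N)).
rewrite val_enum_ord -size_filter.
rewrite (@eq_filter _ _ (fun k => (k < 0 + i.+1)%N)) //.
by rewrite filter_iota_ltn ?size_iota.
Qed.

(** A symmetric matrix is the average of itself and its transpose; expanding both in matrix units
    gives a combination of the generators. *)
Lemma sym_span (R : realType) (d : nat) (M : 'M[R]_d) :
  M^T = M -> M \in <<sym_gens R d>>%VS.
Proof.
move=> Msym.
have gen i j : delta_mx i j + delta_mx j i \in <<sym_gens R d>>%VS.
  apply: memv_span; apply/allpairsPdep.
  have [ji|ij] := leqP j i.
    by exists i, j; split; rewrite ?mem_enum // mem_filter ji mem_enum.
  exists j, i; split; rewrite ?mem_enum 1?addrC //.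
  by rewrite mem_filter ltnW // mem_enum.
have -> : M = \sum_i \sum_j (M i j / 2) *: (delta_mx i j + delta_mx j i).
  under eq_bigr do under eq_bigr do rewrite scalerDr.
  under eq_bigr do rewrite big_split /=.
  (* After the exchange, [delta_mx i j] has coefficient M i j / 2 + M j i / 2, which symmetry turns
     into M i j. *)
  rewrite big_split /= [X in _ + X]exchange_big /=.
  rewrite -big_split /= {1}[M]matrix_sum_delta; apply: eq_bigr => i _.
  rewrite -big_split; apply: eq_bigr => j _ /=.
  by rewrite -{3}Msym mxE -scalerDl -splitr.
by apply: memv_suml => i _; apply: memv_suml => j _; apply: memvZ.
Qed.

(** Freeness makes #|S| the dimension of a span contained in that of [sym_gens], whose dimension is
    at most its number of generators. *)
Lemma free_outer_card (R : realType) (n d : nat) (A : 'M[R]_(n, d))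
    (S : {set 'I_n}) :
  free [seq outer A i | i <- enum S] -> (#|S| <= 'C(d.+1, 2))%N.
Proof.
rewrite /free size_map -cardE => /eqP <-.
rewrite -(size_sym_gens R); apply: leq_trans (dim_span _).
apply/dimvS/span_subvP => _ /mapP[i _ ->].
exact/sym_span/trmx_outer.
Qed.

Lemma design_half_delta (R : realType) (n : nat) (p : 'rV[R]_n) (j : 'I_n) :
  design p -> design (2^-1 *: (p + delta_mx 0 j)).
Proof.
move=> [p0 p1]; split=> [i|]; first by rewrite !mxE mulr_ge0 ?addr_ge0.
under eq_bigr do rewrite !mxE eqxx /=.
rewrite -mulr_sumr big_split /= p1 (bigD1 j) //= eqxx big1 ?addr0.
  by rewrite mulVf.
by move=> i /negPf ->.
Qed.

(** Guarantees that the queries at the midpoints are answered. *)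
Lemma posdef_infomx_half_delta (R : realType) (n d : nat) (A : 'M[R]_(n, d))
    (p : 'rV[R]_n) (j : 'I_n) :
  posdefmx (infomx A p) -> posdefmx (infomx A (2^-1 *: (p + delta_mx 0 j))).
Proof.
move=> Mpd; rewrite infomxZ; apply: posdefmxZ => //.
by rewrite -[delta_mx _ _]scale1r; exact: posdef_infomxD_delta.
Qed.

Lemma facial_hessian_of_answers (R : realType) (n d : nat) (A : 'M[R]_(n, d))
    (S : {set 'I_n}) (p : 'rV[R]_n) :
  posdefmx (infomx A p) ->
  facial_hessian A S p =
    hessian_of_answers S [seq \row_i lev A q i | q <- query_points S p].
Proof.
move=> Mpd; apply/matrixP => k l; rewrite !mxE /=.
(* Answer l+1 is identified as the one at the midpoint of p and e_j, where j is the l-th element of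
   S; the index is in range, so the default is never reached. *)
rewrite -map_comp (nth_map (enum_val l)) -?cardE //= -enum_val_nth !mxE.
rewrite (sqr_cross_lev _ _ _ _ _ _ 1) // scale1r mul1r divr1 lev_half.
  (* The factor 2 from homogeneity cancels the halving in [hessian_of_answers]. *)
  by rewrite mulrAC mulfV // mul1r.
by rewrite -[delta_mx _ _]scale1r; exact: posdef_infomxD_delta.
Qed.

Theorem proposition6p2 (R : realType) (n d : nat) (A : 'M[R]_(n, d))
    (rankA : \rank A = d) :
  [/\ (forall (w : 'rV[R]_n) (j : 'I_n) (t : R),
         posdefmx (infomx A w) -> 0 < t ->
         posdefmx (infomx A (w + t *: delta_mx 0 j)) /\
         forall i : 'I_n,
           cross_lev A w i j ^+ 2 =
             (lev A w i - lev A (w + t *: delta_mx 0 j) i)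
             * ((1 + t * lev A w j) / t)),
      (forall w : 'rV[R]_n, posdefmx (infomx A w) ->
         posdefmx (infomx A (2^-1 *: w)) /\
         forall i : 'I_n, lev A (2^-1 *: w) i = 2 * lev A w i)
    & (forall pstar : 'rV[R]_n,
         optimal_design A pstar -> nondegenerate_design A pstar ->
         let S := contact_set A pstar in
         let m := #|S| in
         (m.+1 <= 'C(d.+1, 2).+1)%N /\
         forall p : 'rV[R]_n, design p -> posdefmx (infomx A p) ->
           [/\ size (query_points S p) = m.+1,
               (forall q, q \in query_points S p -> design q)
             & exists ans : seq 'rV[R]_n,
                 [seq lev_query A q | q <- query_points S p]
                   = [seq Some v | v <- ans] /\
                 facial_hessian A S p = hessian_of_answers S ans])].
Proof.
split=> [w j t Mpd t0|w Mpd|pstar _ [_ _ Sfree] S m].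
- by split=> [|i]; [exact: posdef_infomxD_delta | exact: sqr_cross_lev].
- by split=> [|i]; [rewrite infomxZ; exact: posdefmxZ | exact: lev_half].
split=> [|p pdes Mpd]; first by rewrite ltnS; exact: free_outer_card Sfree.
split; first by rewrite /= size_map -cardE.
- move=> q; rewrite inE => /predU1P[-> //|/mapP[j _ ->]].
  exact: design_half_delta.
(* The answers are the leverage vectors themselves: positive definiteness at p and at each midpoint
   puts every query in the [Some] branch. *)
- exists [seq \row_i lev A q i | q <- query_points S p].
  split; last exact: facial_hessian_of_answers.
  rewrite -map_comp; apply/eq_in_map => q; rewrite inE /lev_query => qP.
  rewrite asboolT //; move: qP => /predU1P[-> //|/mapP[j _ ->]].
  exact: posdef_infomx_half_delta.
Qed.
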